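(* Let $m \neq 1$ be a squarefree integer and let $D_m$ be the ring of integers of the quadratic number field $K = \mathbb{Q}(\sqrt{m}\,)$. Then $D_m$ is a unique factorization domain if and only if $D_m$ is a principal ideal domain. *)

(* Defs.v *)
From HB Require Import structures.
From mathcomp Require Import all_boot all_order all_algebra all_field.
From mathcomp Require Import boolp classical_sets.

Set Implicit Arguments.
Unset Strict Implicit.
Unset Printing Implicit Defensive.

Import GRing.Theory Num.Theory.
Local Open Scope ring_scope.

Definition squarefree_int (m : int) : Prop :=
  forall d : int, (d ^+ 2 %| m)%Z -> d \is a GRing.unit.

(* K stands for a number field: a finite-dimensional field extension of rat.
   Integrality is a Prop-valued notion, reflected here into bool so that
   the ring of integers can be a subType of K. *)
Definition integral_pred (K : fieldExtType rat) : {pred K} :=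
  fun x => `[< integralOver (intr : int -> K) x >].

Lemma integral_predP (K : fieldExtType rat) (x : K) :
  reflect (integralOver (intr : int -> K) x) (x \in @integral_pred K).
Proof. exact: asboolP. Qed.

Lemma integral_subring (K : fieldExtType rat) :
  subring_closed (@integral_pred K).
Proof.
split=> [|x y /integral_predP ix /integral_predP iy
         |x y /integral_predP ix /integral_predP iy]; apply/integral_predP.
- exact: integral1.
- exact: integral_sub.
- exact: integral_mul.
Qed.

Record ring_of_integers (K : fieldExtType rat) := RingOfIntegers {
  int_val :> K;
  int_valP : int_val \in @integral_pred K
}.

Section RingOfIntegersInstances.
Variable K : fieldExtType rat.
Local Notation D := (ring_of_integers K).

HB.instance Definition _ := [isSub for @int_val K].
HB.instance Definition _ := [Choice of D by <:].
HB.instance Definition _ :=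
  GRing.SubChoice_isSubComNzRing.Build K (@integral_pred K) D
    (@integral_subring K).

Definition int_unit : {pred D} :=
  fun x => (val x != 0) && ((val x)^-1 \in @integral_pred K).

Definition int_inv (x : D) : D :=
  if x \in int_unit then insubd x (val x)^-1 else x.

Fact int_mulVx : {in int_unit, left_inverse 1 int_inv *%R}.
Proof.
move=> x ux; rewrite /int_inv ux; move: ux => /andP[x0 ix].
by apply: val_inj; rewrite rmorphM rmorph1 /= val_insubd ix mulVf.
Qed.

Fact int_unitPl (x y : D) : y * x = 1 -> int_unit x.
Proof.
move=> /(congr1 val); rewrite rmorphM rmorph1 /= => yx1.
have x0 : val x != 0.
  by apply/eqP => x0; move/eqP: yx1; rewrite [int_val x]x0 mulr0 eq_sym oner_eq0.
apply/andP; split=> //.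
suff -> : (val x)^-1 = val y by exact: valP.
by apply: (mulIf x0); rewrite mulVf.
Qed.

Fact int_inv_out : {in [predC int_unit], int_inv =1 id}.
Proof. by move=> x; rewrite inE /int_inv => /negbTE->. Qed.

HB.instance Definition _ :=
  GRing.ComNzRing_hasMulInverse.Build D int_mulVx int_unitPl int_inv_out.

Fact int_integral : GRing.integral_domain_axiom D.
Proof.
move=> x y /(congr1 val); rewrite rmorphM rmorph0 => /eqP.
by rewrite mulf_eq0 -!(inj_eq val_inj) rmorph0.
Qed.

HB.instance Definition _ := GRing.ComUnitRing_isIntegral.Build D int_integral.

End RingOfIntegersInstances.

Section Factoriality.
Variable R : idomainType.

Definition irreducible_elt (x : R) : Prop :=
  [/\ x != 0, x \isn't a GRing.unit
    & forall a b : R, x = a * b ->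
        (a \is a GRing.unit) \/ (b \is a GRing.unit)].

Definition associated (x y : R) : Prop :=
  exists2 u : R, u \is a GRing.unit & y = u * x.

Definition same_factors (s t : seq R) : Prop :=
  exists t' : seq R,
    [/\ perm_eq t' t, size s = size t'
      & forall i : nat, (i < size s)%N -> associated s`_i t'`_i].

Definition is_ufd : Prop :=
  (forall x : R, x != 0 -> x \isn't a GRing.unit ->
     exists2 s : seq R,
       {in s, forall p, irreducible_elt p} & x = \prod_(p <- s) p)
  /\
  (forall s t : seq R,
     {in s, forall p, irreducible_elt p} ->
     {in t, forall p, irreducible_elt p} ->
     \prod_(p <- s) p = \prod_(p <- t) p -> same_factors s t).

(* Unlike idealr_closed of ring_quotient, ideals need be neither proper
   nor decidable. *)
Definition is_ideal (I : set R) : Prop :=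
  [/\ I 0, forall x y : R, I x -> I y -> I (x + y)
    & forall a x : R, I x -> I (a * x)].

Definition is_pid : Prop :=
  forall I : set R, is_ideal I ->
    exists g : R, I = [set x | exists a : R, x = a * g]%classic.

End Factoriality.

Arguments is_ufd : clear implicits.
Arguments is_pid : clear implicits.

(* Main.v *)
Require Import Defs.
From mathcomp Require Import all_boot all_order all_algebra all_field.
From mathcomp Require Import boolp classical_sets.
Set Implicit Arguments.
Unset Strict Implicit.
Unset Printing Implicit Defensive.

Import GRing.Theory Num.Theory.
Local Open Scope ring_scope.

(* In a UFD irreducible elements are prime.  In the ring of integers a prime p
   moreover generates a maximal ideal: p divides some integer N > 0, and the
   powers of an integral element b take finitely many values modulo N, so that
   p divides b ^ i * (1 - b ^ k) for some k > 0, whence p | b or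
   p | 1 - b ^ k.  An ideal containing a product p * r with (p) maximal either
   contains r or is of the form p J with r in J, so every nonzero ideal is
   principal by induction on the number of prime factors of one of its
   elements.  Conversely, in a PID an infinite chain of proper divisors would
   generate a principal ideal, whose generator already lies in the ideal of
   some member of the chain, and irreducible elements are prime by Bezout. *)

Section Factorization.
Variable R : idomainType.
Implicit Types (a b c p q u x y z : R) (s t : seq R) (I : set R).

(** * Divisibility, prime elements and factorizations in a UFD *)

Definition divides x y : Prop := exists c, y = c * x.

Definition prime_elt p : Prop :=
  [/\ p != 0, p \isn't a GRing.unit
    & forall a b, divides p (a * b) -> divides p a \/ divides p b].

(** Bezout form of the maximality of the ideal generated by [p], stated without a quotient ring. *)
Definition maximal_elt p : Prop :=
  forall b, ~ divides p b -> exists u v, 1 = u * p + v * b.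

Lemma divides_mull p x y : divides p y -> divides p (x * y).
Proof. by case=> c ->; exists (x * c); rewrite mulrA. Qed.

Lemma divides_trans y x z : divides x y -> divides y z -> divides x z.
Proof. by move=> xy [c ->]; apply: divides_mull. Qed.

Lemma divides_unit x y : divides x y -> y \is a GRing.unit ->
  x \is a GRing.unit.
Proof. by move=> [c ->]; rewrite unitrM => /andP[]. Qed.

Lemma divides_prod s x : x \in s -> divides x (\prod_(y <- s) y).
Proof.
by move=> xs; exists (\prod_(y <- rem x s) y); rewrite mulrC (big_rem x).
Qed.

Lemma irreducible_mul_unit p u : u \is a GRing.unit ->
  irreducible_elt p -> irreducible_elt (u * p).
Proof.
move=> uU [p0 pU pirr]; split.
- by rewrite mulf_neq0 //; apply/eqP => u0; rewrite u0 unitr0 in uU.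
- by rewrite unitrMr.
move=> a b /(congr1 ( *%R u^-1)); rewrite mulKr // mulrA => /pirr [].
  by rewrite unitrMr ?unitrV //; left.
by right.
Qed.

Lemma prime_divides_prod p s : prime_elt p ->
  divides p (\prod_(y <- s) y) -> exists2 q, q \in s & divides p q.
Proof.
move=> pp; have [_ pU pM] := pp;
elim: s => [|a s IHs].
  by rewrite big_nil => p1; case/negP: pU; apply: divides_unit p1 (unitr1 R).
rewrite big_cons => /pM [pa|/IHs [q qs pq]].
  by exists a; rewrite ?mem_head.
by exists q; rewrite // in_cons qs orbT.
Qed.

(** The factor [u] takes care of units, for which [s] is empty. *)
Lemma ufd_factorization x : is_ufd R -> x != 0 ->
  exists u s, [/\ u \is a GRing.unit, {in s, forall p, irreducible_elt p}
    & x = u * \prod_(p <- s) p].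
Proof.
move=> [ex _] x0; have [xU|xU] := boolP (x \is a GRing.unit).
  by exists x, [::]; split; rewrite ?big_nil ?mulr1.
have [s sirr ->] := ex x x0 xU.
by exists 1, s; split; rewrite ?unitr1 ?mul1r.
Qed.

Lemma ufd_irreducible_prime p : is_ufd R -> irreducible_elt p -> prime_elt p.
Proof.
move=> ufd pirr; have [p0 pU _] := pirr; split=> // a b [c abE].
have [->|a0] := eqVneq a 0; first by left; exists 0; rewrite mul0r.
have [->|b0] := eqVneq b 0; first by right; exists 0; rewrite mul0r.
have c0 : c != 0.
  by apply: contra_neq (mulf_neq0 a0 b0) => c0; rewrite abE c0 mul0r.
have [ua [sa [uaU sair aE]]] := ufd_factorization ufd a0.
have [ub [sb [ubU sbir bE]]] := ufd_factorization ufd b0.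
have [uc [sc [ucU scir cE]]] := ufd_factorization ufd c0.
(* All units are gathered in [u] and attached to [p], so that entry 0 of the left list is an
   associate of [p]; uniqueness matches it with a factor of [a] or of [b]. *)
pose u := uc / (ua * ub).
have uabU : ua * ub \is a GRing.unit by rewrite unitrM uaU.
have uU : u \is a GRing.unit by rewrite unitrMl // unitrV.
have prodE : \prod_(q <- u * p :: sc) q = \prod_(q <- sa ++ sb) q.
  rewrite big_cons big_cat /=; apply: (mulrI uabU).
  have uE : ua * ub * u = uc by rewrite /u mulrC mulrVK.
  rewrite [RHS]mulrACA -aE -bE abE cE.
  by rewrite -[u * p * _]mulrA [LHS]mulrA uE -mulrA (mulrC p).
have [||t' [tP tS tA]] := ufd.2 _ _ _ _ prodE.
- move=> q; rewrite in_cons => /orP[/eqP->|/scir //].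
  exact: irreducible_mul_unit.
- by move=> q; rewrite mem_cat => /orP[/sair|/sbir].
have [v vU t0E] := tA 0 (ltn0Sn _).
have : t'`_0 \in sa ++ sb by rewrite -(perm_mem tP) mem_nth // -tS.
have pt : divides p t'`_0 by exists (v * u); rewrite t0E mulrA.
rewrite mem_cat => /orP[] /divides_prod /(divides_trans pt) pd.
  by left; rewrite aE; apply: divides_mull.
by right; rewrite bE; apply: divides_mull.
Qed.

(** * From unique factorization to principal ideals *)

Definition principal I : Prop :=
  exists g, I = [set x | exists a : R, x = a * g]%classic.

Lemma principalP I g : is_ideal I -> I g -> (forall x, I x -> divides g x) ->
  principal I.
Proof.
move=> [_ _ IM] Ig gI; exists g; apply/seteqP; split=> x /=; first exact: gI.
by move=> [a ->]; apply: IM.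
Qed.

Lemma ideal_prod_principal s I : is_ideal I ->
  {in s, forall p, maximal_elt p} -> I (\prod_(p <- s) p) -> principal I.
Proof.
elim: s I => [|p s IHs] I Iid smax.
  rewrite big_nil => I1; apply: (@principalP _ 1) => // x _.
  by exists x; rewrite mulr1.
have [I0 ID IM] := Iid.
have smax' : {in s, forall q, maximal_elt q}.
  by move=> q qs; apply: smax; rewrite in_cons qs orbT.
rewrite big_cons; set r := \prod_(_ <- _) _ => Ipr.
have [Ip|/existsNP [b /not_implyP [Ib pb]]] :=
  pselect (forall x, I x -> divides p x).
  (* Here [I = p J] with [J] the colon ideal of [I] by [p], which contains the shorter product
     [r]. *)
  pose J : set R := fun z => I (p * z).
  have Jid : is_ideal J.
    rewrite /J; split=> [|x y Jx Jy|a x Jx]; first by rewrite mulr0.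
      by rewrite mulrDr; apply: ID.
    by rewrite mulrCA; apply: IM.
  have [g JE] := IHs J Jid smax' Ipr.
  have JP z : J z <-> exists a, z = a * g by rewrite JE.
  apply: (@principalP _ (p * g)) => //.
    by apply/JP; exists 1; rewrite mul1r.
  move=> x Ix; have [c xE] := Ip x Ix.
  have /JP [a cE] : J c by rewrite /J mulrC -xE.
  by exists a; rewrite xE cE -mulrA (mulrC g).
(* Since [b] lies in [I] but not in [(p)], [r = u p r + v b r] lies in [I], and the induction
   applies to [I] itself. *)
have [u [v uvE]] := smax p (mem_head _ _) b pb.
apply: IHs smax' _ => //; rewrite -/r -[r]mul1r uvE mulrDl.
apply: ID; first by rewrite -mulrA; apply: IM.
by rewrite mulrAC; apply: IM.
Qed.

Lemma ufd_pid : is_ufd R -> (forall p, prime_elt p -> maximal_elt p) ->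
  is_pid R.
Proof.
move=> ufd pmax I Iid; have [I0 ID IM] := Iid.
have [I_0|/existsNP [x /not_implyP [Ix /eqP x0]]] :=
  pselect (forall x, I x -> x = 0).
  by apply: (@principalP _ 0) => // x /I_0 ->; exists 0; rewrite mul0r.
have [u [s [uU sirr xE]]] := ufd_factorization ufd x0.
apply: (@ideal_prod_principal s) => //.
  by move=> p /sirr /(ufd_irreducible_prime ufd) /pmax.
by rewrite -(mulKr uU (\prod_(p <- s) p)) -xE; apply: IM.
Qed.

(** * From principal ideals to unique factorization *)

Lemma pid_irreducible_prime p : is_pid R -> irreducible_elt p -> prime_elt p.
Proof.
move=> pid [p0 pU pirr]; split=> // a b pab.
pose I : set R := fun z => exists u v, z = u * p + v * a.
have Iid : is_ideal I.
  split=> [|_ _ [u [v ->]] [u' [v' ->]]|c _ [u [v ->]]].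
  - by exists 0, 0; rewrite !mul0r addr0.
  - by exists (u + u'), (v + v'); rewrite !mulrDl addrACA.
  - by exists (c * u), (c * v); rewrite mulrDr !mulrA.
have [g IE] := pid I Iid.
have IP z : I z <-> exists c, z = c * g by rewrite IE.
have /IP [c pE] : I p by exists 1, 0; rewrite mul1r mul0r addr0.
have /IP [d aE] : I a by exists 0, 1; rewrite mul1r mul0r add0r.
have [cU|gU] := pirr _ _ pE.
  by left; exists (d / c); rewrite aE pE mulrA mulrVK.
have /IP [u [v gE]] : exists e, g = e * g by exists 1; rewrite mul1r.
have [w abE] := pab.
(* From [g = u p + v a] and [a b = w p] follows [g b = (u b + v w) p], and [g] is a unit. *)
right; exists (g^-1 * (u * b + v * w)).
rewrite -[LHS](mulKr gU) -mulrA; congr (_ * _).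
by rewrite {1}gE !mulrDl -!mulrA abE (mulrC p).
Qed.

Lemma pid_factorization x : is_pid R -> x != 0 -> x \isn't a GRing.unit ->
  exists2 s, {in s, forall p, irreducible_elt p} & x = \prod_(p <- s) p.
Proof.
move=> pid.
pose factors y :=
  exists2 s, {in s, forall p, irreducible_elt p} & y = \prod_(p <- s) p.
pose bad y := [/\ y != 0, y \isn't a GRing.unit & ~ factors y].
(* Keeping [bad y] under the existential makes the relation total, as [choice] requires; 0 is a
   dummy value. *)
have step y : exists z, bad y -> [/\ bad z, divides z y & ~ divides y z].
  have [|nb] := pselect (bad y); last by exists 0.
  move=> [y0 yU yf].
  have [z zP] : exists z, [/\ bad z, divides z y & ~ divides y z]; last first.
    by exists z.
  (* Without a bad proper divisor [y] is irreducible: two nonunit cofactors would both factor, and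
     then so would [y]. *)
  apply: contrapT => /forallNP noz; apply: (yf).
  exists [:: y]; last by rewrite big_seq1.
  move=> _ /[!inE] /eqP ->; split=> // a b yE.
  have factor c d : y = c * d -> c \isn't a GRing.unit ->
      d \isn't a GRing.unit -> factors c.
    move=> cdE cU dU; apply: contrapT => cf; apply: (noz c).
    have c0 : c != 0 by apply: contra_neq y0 => c0; rewrite cdE c0 mul0r.
    split=> //; first by exists d; rewrite mulrC.
    move=> [e cE]; move/negP: dU; apply; apply/unitrPr; exists e.
    by apply: (mulfI c0); rewrite mulr1 mulrA -cdE mulrC -cE.
  have [aU|aU] := boolP (a \is a GRing.unit); first by left.
  have [bU|bU] := boolP (b \is a GRing.unit); first by right.
  have [sa sair aE] := factor a b yE aU bU.
  have [sb sbir bE] : factors b by apply: factor bU aU; rewrite mulrC.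
  exfalso; apply: yf; exists (sa ++ sb).
    by move=> p; rewrite mem_cat => /orP[/sair|/sbir].
  by rewrite big_cat /= -aE -bE.
have [f fP] := choice step.
move=> x0 xU; apply: contrapT => xf.
pose ch n := iter n f x.
have chbad n : bad (ch n).
  by elim: n => [|n /fP []].
(* The union of the increasing chain of ideals generated by the [ch n]. *)
pose I : set R := fun z => exists n, divides (ch n) z.
have ch_le n k : divides (ch (k + n)%N) (ch n).
  elim: k => [|k IHk]; first by exists 1; rewrite mul1r.
  by have [_ h _] := fP _ (chbad (k + n)%N); apply: divides_trans h IHk.
have Iid : is_ideal I.
  split=> [|y z [n ny] [k kz]|a y [n ny]].
  - by exists 0, 0; rewrite mul0r.
  - have [c yE] := divides_trans (ch_le n k) ny.
    have := divides_trans (ch_le k n) kz; rewrite addnC => -[d zE].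
    by exists (k + n)%N, (c + d); rewrite mulrDl -yE -zE.
  - by exists n; apply: divides_mull.
have [g IE] := pid I Iid.
have IP z : I z <-> divides g z by rewrite IE.
have [n ng] : I g by apply/IP; exists 1; rewrite mul1r.
have gn : divides g (ch n.+1) by apply/IP; exists n.+1, 1; rewrite mul1r.
have [_ _ []] := fP _ (chbad n).
exact: divides_trans ng gn.
Qed.

(** The unit [u] makes the induction work: cancelling [p] against its associate [q = v p] leaves the
    unit [v] behind. *)
Lemma prime_unique_factorization u s t :
  u \is a GRing.unit -> {in s, forall p, prime_elt p} ->
  {in t, forall q, irreducible_elt q} ->
  \prod_(p <- s) p = u * \prod_(q <- t) q -> same_factors s t.
Proof.
elim: s u t => [|p s IHs] u t uU sP tI.
  rewrite big_nil => stE; exists [::]; split=> //.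
  case: t tI stE => // q t tI; rewrite big_cons mulrCA => stE.
  have [_ /negP[]] := tI q (mem_head _ _).
  by apply/unitrPr; exists (u * \prod_(q <- t) q).
have pP := sP p (mem_head _ _); have [p0 pU _] := pP.
rewrite big_cons => stE.
have ut : divides p (\prod_(q <- t) q).
  by exists (u^-1 * \prod_(q <- s) q); rewrite mulrAC -mulrA stE mulKr.
have [q qt [v qE]] := prime_divides_prod pP ut.
have vU : v \is a GRing.unit.
  by have [_ _ /(_ _ _ qE) []] := tI q qt => //; rewrite (negbTE pU).
have [||||t' [tP tS tA]] := IHs (u * v) (rem q t).
- by rewrite unitrM uU.
- by move=> x xs; apply: sP; rewrite in_cons xs orbT.
- by move=> x /mem_rem /tI.
- apply: (mulfI p0); rewrite stE (big_rem q) //= qE.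
  by rewrite !mulrA; congr (_ * _); rewrite mulrC mulrA.
exists (q :: t'); split=> /=; last by case=> [|i] //=; [exists v | apply: tA].
  by rewrite (perm_trans _ (_ : perm_eq (q :: rem q t) t)) ?perm_cons //
             perm_sym perm_to_rem.
by rewrite tS.
Qed.

Lemma pid_ufd : is_pid R -> is_ufd R.
Proof.
move=> pid; split=> [x|s t sI tI stE]; first exact: pid_factorization.
apply: (prime_unique_factorization (unitr1 R) _ tI); last by rewrite mul1r.
by move=> p /sI; apply: pid_irreducible_prime.
Qed.

End Factorization.

(** * Integer polynomial relations and powers modulo an integer *)

Lemma root_divides_int (R : idomainType) (x : R) (P : {poly int}) :
  x != 0 -> P != 0 -> (map_poly intr P).[x] = 0 ->
  exists2 n : int, n != 0 & divides x n%:~R.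
Proof.
move=> x0; elim/poly_ind: P => [|P c IHP]; first by rewrite eqxx.
(* Factors [X] are removed, as [x] is nonzero, until the constant term is a nonzero integer, which
   is then a multiple of [x]. *)
have [->|c0] := eqVneq c 0.
  rewrite addr0 mulf_eq0 polyX_eq0 orbF => P0.
  rewrite rmorphM /= map_polyX hornerMX => /eqP.
  by rewrite mulf_eq0 (negbTE x0) orbF => /eqP /(IHP P0).
move=> _; rewrite rmorphD rmorphM /= map_polyX map_polyC hornerMXaddC /= => h.
exists c => //; exists (- (map_poly intr P).[x]).
by rewrite mulNr; apply/eqP; rewrite -addr_eq0 addrC h.
Qed.

Lemma nat_pigeonhole (T : finType) (f : nat -> T) :
  exists i k, f i = f (i + k.+1)%N.
Proof.
pose g (i : 'I_#|T|.+1) := f i.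
have /injectivePn [i [j ij gij]] : ~~ injectiveb g.
  by apply/injectiveP => /leq_card; rewrite card_ord ltnn.
wlog lt_ij : i j ij gij / (i < j)%N => [IH|].
  have /orP[] : (i < j)%N || (j < i)%N by rewrite -neq_ltn.
    exact: IH.
  by apply: IH; rewrite 1?eq_sym.
by exists i, (j - i).-1; rewrite prednK ?subn_gt0 // subnKC // ltnW.
Qed.

(** Reducing [X^i] modulo the monic [P], then its coefficients modulo [n], leaves finitely many
    classes, so two powers collide. *)
Lemma integral_powers_mod (R : idomainType) (b : R) (P : {poly int}) (n : int) :
  P \is monic -> (map_poly intr P).[b] = 0 -> n != 0 ->
  exists i k, divides n%:~R (b ^+ i - b ^+ (i + k.+1)).
Proof.
move=> Pmon Pb n0.
pose r i := Pdiv.Ring.rmodp 'X^i P.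
have rE i : b ^+ i = (map_poly intr (r i)).[b].
  rewrite -[LHS]hornerXn -(map_polyXn intr).
  rewrite [in LHS](Pdiv.RingMonic.rdivp_eq Pmon 'X^i).
  by rewrite rmorphD rmorphM /= hornerD hornerM Pb mulr0 add0r.
have r_size i : (size (r i) <= size P)%N.
  by rewrite ltnW // Pdiv.Ring.ltn_rmodpN0 // monic_neq0.
(* Residues are below [|n|]; the successor in the bound is there for [inord]. *)
pose f i : {ffun 'I_(size P) -> 'I_(`|n|%N.+1)} :=
  [ffun l : 'I__ => inord `|((r i)`_l %% n)%Z|%N].
have [i [k /ffunP fE]] := nat_pigeonhole f.
have r_coef l : (l < size P)%N ->
    exists q : int, (r i)`_l - (r (i + k.+1)%N)`_l = q * n.
  move=> lP; apply/dvdzP; rewrite -eqz_mod_dvd.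
  have := congr1 val (fE (Ordinal lP)); rewrite !ffunE /= !inordK; last 2 first.
  - by rewrite ltnS ltnW // -ltz_nat gez0_abs ?modz_ge0 ?ltz_mod.
  - by rewrite ltnS ltnW // -ltz_nat gez0_abs ?modz_ge0 ?ltz_mod.
  by move/(congr1 Posz); rewrite !gez0_abs ?modz_ge0 // => ->.
exists i, k; rewrite !rE.
have map_size j : (size (map_poly intr (r j) : {poly R}) <= size P)%N.
  exact: leq_trans (size_poly _ _) (r_size j).
rewrite !(horner_coef_wide _ (map_size _)) -sumrB.
apply: (big_ind (divides n%:~R)) => [|_ _ [y ->] [z ->]|l _].
- by exists 0; rewrite mul0r.
- by exists (y + z); rewrite mulrDl.
have [q qE] := r_coef l (ltn_ord l).
exists (q%:~R * b ^+ l); rewrite !coef_map -mulrBl -rmorphB qE rmorphM /=.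
by rewrite mulrAC.
Qed.

(** * Application to rings of integers *)

Section RingOfIntegers.
Variable K : fieldExtType rat.
Local Notation D := (ring_of_integers K).

Lemma ring_of_integers_integral (x : D) :
  exists2 P : {poly int}, P \is monic & (map_poly intr P).[x] = 0.
Proof.
have /integral_predP [P Pmon /rootP Px] := valP x; exists P => //.
apply: val_inj; rewrite raddf0 -{}Px -horner_map -map_poly_comp /=.
congr _.[_]; apply: eq_map_poly => n.
exact: (rmorph_int (val : {rmorphism D -> K})).
Qed.

Lemma ring_of_integers_prime_maximal (p : D) : prime_elt p -> maximal_elt p.
Proof.
move=> pP b pb; have [p0 pU pM] := pP.
have [P Pmon Pp] := ring_of_integers_integral p.
have [n n0 pn] := root_divides_int p0 (monic_neq0 Pmon) Pp.
have [Q Qmon Qb] := ring_of_integers_integral b.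
have [i [k nd]] := integral_powers_mod Qmon Qb n0.
have pX j : ~ divides p (b ^+ j).
  elim: j => [p1|j IHj]; last by rewrite exprS => /pM [].
  by case/negP: pU; apply: divides_unit p1 (unitr1 D).
have := divides_trans pn nd.
(* As [p] divides no power of [b], it divides [1 - b ^ k.+1], which is a Bezout relation between [p]
   and [b]. *)
rewrite exprD -[X in X - _]mulr1 -mulrBr => /pM [/pX //|[c cE]].
by exists c, (b ^+ k); rewrite -cE -exprSr subrK.
Qed.

Lemma ring_of_integers_ufd_pid : is_ufd D <-> is_pid D.
Proof.
split=> [ufd|]; last exact: pid_ufd.
exact: ufd_pid ufd ring_of_integers_prime_maximal.
Qed.

End RingOfIntegers.

Theorem corollary4 (m : int) (m_neq1 : m <> 1) (m_sqf : squarefree_int m)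
    (K : fieldExtType rat) (sqrt_m : K)
    (sqrt_mE : sqrt_m ^+ 2 = m%:~R)
    (K_gen : <<1; sqrt_m>>%VS = fullv) :
  is_ufd (ring_of_integers K) <-> is_pid (ring_of_integers K).
Proof. exact: ring_of_integers_ufd_pid. Qed.
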